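(* Let $(X,d)$ be a compact metric space, $(X,f_{1,\infty})$ a nonautonomous dynamical system, and $K$ a nonempty subset of $X$. If the sequence $f_{1,\infty}$ is equicontinuous, then for any integer $k\ge1$, $$\overline{D}_K(f_{1,\infty}^k)=\overline{D}_K(f_{1,\infty})\ge\underline{D}_K(f_{1,\infty}^k)=\underline{D}_K(f_{1,\infty}).$$
   Context: A nonautonomous dynamical system $(X,f_{1,\infty})$ consists of a compact space $X$ and a sequence $f_{1,\infty}=(f_i)_{i\ge 1}$ of continuous maps $f_i:X\to X$. Put $f_i^0=\mathrm{id}_X$ and $f_i^j=f_{i+j-1}\circ\cdots\circ f_{i+1}\circ f_i$. For an integer $k\ge1$, $f_{1,\infty}^k$ denotes the sequence of maps $(f_1^k,f_{k+1}^k,f_{2k+1}^k,\dots)$. The sequence $f_{1,\infty}$ is equicontinuous if for any $\varepsilon>0$ there is $\delta>0$ such that $d(f_i(x),f_i(y))<\varepsilon$ for all $i\ge1$ whenever $d(x,y)<\delta$. Upper and lower topological entropy dimension of a sequence $g_{1,\infty}=(g_i)_{i\ge1}$ of continuous selfmaps of $X$ on nonempty $K\subseteq X$ (applied above to $g_{1,\infty}=f_{1,\infty}$ and $f_{1,\infty}^k$). Put $g_1^0=\mathrm{id}_X$, $g_1^j=g_j\circ\cdots\circ g_1$. For a finite open cover $\mathcal{U}$ of $X$ let $\mathcal{U}_1^n$ be the cover of all sets $\bigcap_{j=0}^{n-1}(g_1^j)^{-1}(U_j)$ with $U_j\in\mathcal{U}$, and let $\mathcal{N}(\mathcal{U}_1^n|_K)$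 be the minimal number of members of $\{V\cap K: V\in\mathcal{U}_1^n\}$ needed to cover $K$. For $s>0$ set $\overline{h}_K(g_{1,\infty},s)=\sup_{\mathcal{U}}\limsup_{n\to\infty}\frac{1}{n^s}\log\mathcal{N}(\mathcal{U}_1^n|_K)$ and $\underline{h}_K(g_{1,\infty},s)=\sup_{\mathcal{U}}\liminf_{n\to\infty}\frac{1}{n^s}\log\mathcal{N}(\mathcal{U}_1^n|_K)$, suprema over all finite open covers of $X$. Then $\overline{D}_K(g_{1,\infty})=\inf\{s>0:\overline{h}_K(g_{1,\infty},s)=0\}=\sup\{s>0:\overline{h}_K(g_{1,\infty},s)=\infty\}$ and $\underline{D}_K(g_{1,\infty})=\inf\{s>0:\underline{h}_K(g_{1,\infty},s)=0\}=\sup\{s>0:\underline{h}_K(g_{1,\infty},s)=\infty\}$, with $\inf\emptyset=+\infty$ and $\sup\emptyset=0$. *)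

(* Defs.v *)
From HB Require Import structures.
From mathcomp Require Import all_boot all_order all_algebra.
From mathcomp Require Import all_classical all_reals all_analysis.

Set Implicit Arguments.
Unset Strict Implicit.
Unset Printing Implicit Defensive.

Import Order.TTheory GRing.Theory Num.Theory.
Import numFieldNormedType.Exports.

Local Open Scope classical_set_scope.
Local Open Scope ring_scope.

(* Sequences of maps are indexed from 0: [f i] stands for f_(i+1), and
   [nds_iter f i j] for f_(i+1)^j = f_(i+j) o ... o f_(i+1). *)
Fixpoint nds_iter (X : Type) (f : nat -> X -> X) (i j : nat) : X -> X :=
  if j is j'.+1 then f (i + j')%N \o nds_iter f i j' else id.

(* The sequence (f_1^k, f_(k+1)^k, f_(2k+1)^k, ...). *)
Definition nds_power (X : Type) (f : nat -> X -> X) (k : nat) : nat -> X -> X :=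
  fun m => nds_iter f (m * k) k.

(* Uniform in the base point, unlike the pointwise [equicontinuous]. *)
Definition equicontinuous_seq (R : realType) (X : metricType R)
    (f : nat -> X -> X) : Prop :=
  forall e : R, 0 < e -> exists2 d : R, 0 < d &
    forall (i : nat) (x y : X), mdist x y < d -> mdist (f i x) (f i y) < e.

Definition finite_open_cover (X : topologicalType) (U : set (set X)) : Prop :=
  [/\ finite_set U, (forall V, U V -> open V) & \bigcup_(V in U) V = setT].

(* The cover U_1^n for the sequence g. *)
Definition cover_join (X : Type) (g : nat -> X -> X) (U : set (set X))
    (n : nat) : set (set X) :=
  [set V | exists2 u : nat -> set X, (forall j, (j < n)%N -> U (u j)) &
     V = \bigcap_(j in `I_n) (nds_iter g 0 j @^-1` u j)].

(* The least element of P; the value 0 is a default for P empty. *)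
Definition least_nat (P : set nat) : nat :=
  xget 0%N [set m | P m /\ forall m', P m' -> (m <= m')%N].

(* N(W|_K): the minimal number of members of { V `&` K | V in W } whose union
   contains K. *)
Definition cover_number (X : Type) (W : set (set X)) (K : set X) : nat :=
  least_nat [set m | exists C : set (set X),
    [/\ C `<=` [set V `&` K | V in W], (C #= `I_m)%card & K `<=` \bigcup_(V in C) V]].

Section entropy_dimension.
Context (R : realType) (X : topologicalType).
Implicit Types (K : set X) (g : nat -> X -> X) (U : set (set X)) (s : R).

(* The value at n = 0 is irrelevant to the limits below. *)
Definition cover_growth K g s U (n : nat) : \bar R :=
  ((n%:R `^ s)^-1 * ln (cover_number (cover_join g U n) K)%:R)%:E.

Definition upper_entropy K g s : \bar R :=
  ereal_sup [set limn_esup (cover_growth K g s U) | U in @finite_open_cover X].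

Definition lower_entropy K g s : \bar R :=
  ereal_sup [set limn_einf (cover_growth K g s U) | U in @finite_open_cover X].

(* Since an entropy that is finite at s vanishes at every t > s, these infima
   are also the suprema of the s > 0 of infinite entropy (0 if there is none). *)
Definition upper_entropy_dim K g : \bar R :=
  ereal_inf [set s%:E | s in [set s : R | 0 < s /\ upper_entropy K g s = 0%E]].

Definition lower_entropy_dim K g : \bar R :=
  ereal_inf [set s%:E | s in [set s : R | 0 < s /\ lower_entropy K g s = 0%E]].

End entropy_dimension.

(* Main.v *)
Require Import Defs.
From HB Require Import structures.
From mathcomp Require Import all_boot all_order all_algebra.
From mathcomp Require Import finmap.
From mathcomp Require Import all_classical all_reals all_analysis.
From mathcomp Require Import zify.

(** An entropy dimension only depends on the set of exponents at which the
    entropy vanishes, so it suffices to show that f and its k-th power g have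
    vanishing upper (resp. lower) entropy at the same exponents s.  Write
    N(f, U, n) for the minimal number of members of U_1^n needed to cover K.

    One comparison needs nothing of f: the join of U along 0, k, ..., (n-1)k is
    coarser than the join along all times below nk, so
    N(g, U, n) <= N(f, U, nk).  The converse is where equicontinuity enters.
    For a Lebesgue number e of U, the finitely many partial iterates
    f_i^j with j < k admit, uniformly in i, a common d such that they map
    d-balls into e-balls; a finite cover V by sets of radius d therefore has
    the property that each f_i^j, j < k, sends each member of V into some
    member of U.  Splitting a time below nk as jk + r then shows that the join
    of V along g at length n refines that of U along f at length nk, so
    N(f, U, nk) <= N(g, V, n) ([equicontinuous_cover],
    [cover_join_refines_power]).

    Both comparisons have the shape N(h, U, na) <= N(g, V, nb).  As N is
    nondecreasing in n, such a bound along multiples extends to all times at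
    the price of rescaling time by a bounded factor c, which multiplies the
    growth rate by at most c^s and so preserves the vanishing of both limits
    ([entropy_eq0_transfer]).  Finally, the lower dimension is at most the
    upper one because a liminf is at most the limsup. *)

Set Implicit Arguments.
Unset Strict Implicit.
Unset Printing Implicit Defensive.

Import Order.TTheory GRing.Theory Num.Theory.
Import numFieldNormedType.Exports.

Local Open Scope classical_set_scope.
Local Open Scope ring_scope.

(** * Minimal cardinality of subcovers *)

Section least_nat.
Implicit Type P : set nat.

Lemma least_natP P m : P m ->
  P (least_nat P) /\ forall m', P m' -> (least_nat P <= m')%N.
Proof.
move=> Pm; rewrite /least_nat.
have ex : exists n, `[< P n >] by exists m; exact/asboolP.
case: xgetP => [n _ []//|/(_ (ex_minn ex))[]].
case: ex_minnP => n /asboolP Pn nmin; split => // m' Pm'.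
by apply: nmin; exact/asboolP.
Qed.

Lemma least_nat_le P m : P m -> (least_nat P <= m)%N.
Proof. by move=> Pm; case: (least_natP Pm) => _; exact. Qed.

End least_nat.

Definition refines (X : Type) (W' W : set (set X)) :=
  forall V', W' V' -> exists2 V, W V & V' `<=` V.

Section covers.
Variable X : Type.
Implicit Types (W U : set (set X)) (K : set X) (g : nat -> X -> X).

(** Enlarging each set of an optimal subcover from W' to a member of W cannot
    increase the number of sets.  Finiteness of the finer cover matters:
    otherwise its cover number could be the default value 0. *)
Lemma cover_number_le W W' K : finite_set W' -> \bigcup_(V in W') V = setT ->
  refines W' W -> (cover_number W K <= cover_number W' K)%N.
Proof.
move=> finW' covW' ref.
have [m cardm] : finite_set [set V `&` K | V in W'].
  exact: finite_image.
have [|[C' [C'W' cardC' K_C']] _] := @least_natP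
    [set m | exists C : set (set X), [/\ C `<=` [set V `&` K | V in W'],
      (C #= `I_m)%card & K `<=` \bigcup_(V in C) V]] m.
  exists [set V `&` K | V in W']; split => //.
  move=> x Kx; have : (\bigcup_(V in W') V) x by rewrite covW'.
  by move=> [V W'V Vx]; exists (V `&` K) => //; exists V.
have /choice[phi phiP] : forall A, exists B,
    C' A -> [set V `&` K | V in W] B /\ A `<=` B.
  move=> A; have [C'A|nC'A] := pselect (C' A); last by exists A.
  have [V' /ref[V WV V'V] <-] := C'W' _ C'A.
  by exists (V `&` K) => _; split; [exists V|exact: setSI].
have [p cardp] : finite_set (phi @` C').
  by apply: finite_image; eexists; exact: cardC'.
have pn : (p <= cover_number W' K)%N.
  rewrite -card_le_II -(card_le_eql cardp) -(card_le_eqr cardC').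
  exact: card_image_le.
apply: leq_trans pn; apply: least_nat_le; exists (phi @` C'); split => //.
- by move=> _ [A C'A <-]; have [] := phiP A C'A.
- by move=> x /K_C'[A C'A Ax]; exists (phi A); [exists A|apply: (phiP A C'A).2].
Qed.

Lemma finite_cover_join g U n : finite_set U -> finite_set (cover_join g U n).
Proof.
move=> finU; elim: n => [|n IHn].
  apply: (@sub_finite_set _ _ [set setT]); last exact: finite_set1.
  by move=> _ [u _ ->]; apply/seteqP; split => // x _ j /=.
apply: (@sub_finite_set _ _
    [set V `&` (nds_iter g 0 n @^-1` A) | V in cover_join g U n & A in U]).
  move=> _ [u uU ->]; exists (\bigcap_(j in `I_n) (nds_iter g 0 j @^-1` u j)).
    by exists u => // j jn; apply: uU; exact: ltnW.
  exists (u n); first exact: uU.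
  apply/seteqP; split=> [x [xu xn] j /=|x xu].
    by rewrite ltnS leq_eqVlt => /predU1P[->//|]; exact: xu.
  by split => [j /= jn|]; apply: xu => //=; exact: ltnW.
exact: finite_image2.
Qed.

Lemma cover_join_cover g U n : \bigcup_(V in U) V = setT ->
  \bigcup_(V in cover_join g U n) V = setT.
Proof.
move=> covU; apply/seteqP; split => // x _.
have /choice[u uP] : forall j, exists A, U A /\ A (nds_iter g 0 j x).
  move=> j; have : (\bigcup_(V in U) V) (nds_iter g 0 j x) by rewrite covU.
  by move=> [A UA Ax]; exists A.
exists (\bigcap_(j in `I_n) (nds_iter g 0 j @^-1` u j)).
  by exists u => // j _; have [] := uP j.
by move=> j _; have [] := uP j.
Qed.

Lemma cover_join_refines g U m n : (m <= n)%N ->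
  refines (cover_join g U n) (cover_join g U m).
Proof.
move=> mn _ [u uU ->]; exists (\bigcap_(j in `I_m) (nds_iter g 0 j @^-1` u j)).
  by exists u => // j jm; apply: uU; exact: leq_trans mn.
by move=> x xu j /= jm; apply: xu; exact: leq_trans mn.
Qed.

End covers.

(** * Comparing joins along a sequence and along its k-th power *)

Section iterates.
Variables (X : Type) (f : nat -> X -> X).

Lemma nds_iterD i a b x :
  nds_iter f i (a + b) x = nds_iter f (i + a) b (nds_iter f i a x).
Proof. by elim: b => [|b IHb]; rewrite ?addn0// addnS /= IHb addnA. Qed.

Lemma nds_iter_power k n x :
  nds_iter (nds_power f k) 0 n x = nds_iter f 0 (n * k) x.
Proof.
by elim: n => [//|n IHn]; rewrite mulSn addnC nds_iterD/= IHn add0n.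
Qed.

Lemma cover_join_power_refines (U : set (set X)) k n : (0 < k)%N ->
  refines (cover_join f U (n * k)) (cover_join (nds_power f k) U n).
Proof.
move=> k0 _ [u uU ->].
exists (\bigcap_(j in `I_n) (nds_iter (nds_power f k) 0 j @^-1` u (j * k)%N)).
  by exists (fun j => u (j * k)%N) => // j jn; apply: uU; rewrite ltn_pmul2r.
move=> x xu j /= jn; rewrite nds_iter_power.
by apply: xu; rewrite /= ltn_pmul2r.
Qed.

(** A time i = j k + r with r < k is reached by j steps of the k-th power, which
    end in a member of V, followed by the partial iterate of length r starting
    at time j k, which maps that member into a member of U. *)
Lemma cover_join_refines_power (U V : set (set X)) k n : (0 < k)%N ->
  (forall i j A, (j < k)%N -> V A ->
    exists2 B, U B & A `<=` nds_iter f i j @^-1` B) ->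
  refines (cover_join (nds_power f k) V n) (cover_join f U (n * k)).
Proof.
move=> k0 VU _ [v vV ->].
have /choice[u uP] : forall i, exists B, (i < n * k)%N ->
    U B /\ v (i %/ k)%N `<=` nds_iter f (i %/ k * k) (i %% k) @^-1` B.
  move=> i; have [ink|_] := boolP (i < n * k)%N; last by exists set0.
  have [|B UB vB] := VU (i %/ k * k)%N (i %% k)%N (v (i %/ k)%N) (ltn_pmod _ k0).
    by apply: vV; rewrite ltn_divLR.
  by exists B.
exists (\bigcap_(i in `I_(n * k)) (nds_iter f 0 i @^-1` u i)).
  by exists u => // i /uP[].
move=> x xv i /= ink; rewrite [i in nds_iter _ _ i](divn_eq i k) nds_iterD.
apply: (uP i ink).2; rewrite -nds_iter_power.
by apply: xv; rewrite /= ltn_divLR.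
Qed.

End iterates.

(** * Equicontinuity and finite covers *)

(** The characterization [compact_cover] is about pointed spaces, so the empty
    set is treated apart, and any other set supplies a point. *)
Lemma compact_cover_compact (T : topologicalType) (A : set T) :
  compact A -> cover_compact A.
Proof.
have [->|/set0P[t0 _]] := eqVneq A set0.
  by move=> _ I D F _ _; exists fset0%fset.
pose pT : ptopologicalType := HB.pack T (isPointed.Build T t0).
by rewrite -[compact A]/(@compact pT A) compact_cover.
Qed.

Section lebesgue.
Variables (R : realType) (X : metricType R).

(** Compactness is used as [near_covering]: around each x the property that the
    d-ball lies in a member of U holds for all nearby points and all small d,
    hence it holds on the whole space for all small d. *)
Lemma lebesgue_number (U : set (set X)) : compact [set: X] ->
  finite_open_cover U ->
  exists2 d : R, 0 < d & forall x, exists2 B, U B & ball x d `<=` B.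
Proof.
move=> /compact_near_coveringP cX [_ oU covU].
have near_d : \forall d \near 0^'+,
    [set: X] `<=` [set x | exists2 B, U B & ball x d `<=` B].
  apply: (cX R 0^'+ (fun d x => exists2 B, U B & ball x d `<=` B) _) => x _.
  have [B UB Bx] : (\bigcup_(V in U) V) x by rewrite covU.
  have /nbhs_ballP[e /= e0 eB] : nbhs x B.
    by apply: open_nbhs_nbhs; split => //; exact: oU.
  exists (ball x (e / 2), [set d : R | d < e / 2]) => /=.
    split; first by apply: nbhsx_ballx; rewrite divr_gt0.
    by apply: nbhs_right_lt; rewrite divr_gt0.
  move=> [y d] /= [xy de]; exists B => // z yz; apply: eB.
  by rewrite [e]splitr; apply: ball_triangle xy _; apply: le_ball yz; exact: ltW.
have [d dP d0] : exists2 d : R,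
    [set: X] `<=` [set x | exists2 B, U B & ball x d `<=` B] & 0 < d.
  have pos : \forall d \near 0^'+, (0 < d :> R) by exact: nbhs_right_gt.
  by have [d [dP d0]] := @filter_ex _ _ (at_right_proper_filter (0 : R)) _
    (filterI near_d pos); exists d.
by exists d => // x; exact: dP.
Qed.

Lemma finite_ball_cover (d : R) : compact [set: X] -> 0 < d ->
  exists2 V : set (set X), finite_open_cover V &
    forall A, V A -> exists x, A `<=` ball x d.
Proof.
move=> /compact_cover_compact cX d0.
have [||D _ covD] := cX X setT (fun x => (ball x d)^°).
- by move=> x _; exact: open_interior.
- by move=> x _; exists x => //; exact: nbhsx_ballx.
exists [set (ball x d)^° | x in [set` D]].
  split.
  - by apply: finite_image; exact: finite_fset.
  - by move=> _ [x _ <-]; exact: open_interior.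
  - apply/seteqP; split => // x _.
    have [y Dy yx] := covD x I.
    by exists (ball y d)^°; [exists y|].
by move=> _ [x _ <-]; exists x; exact: interior_subset.
Qed.

Lemma equicontinuous_iter (f : nat -> X -> X) k : equicontinuous_seq f ->
  forall e : R, 0 < e -> exists2 d : R, 0 < d &
    forall i j x y, (j < k)%N -> ball x d y ->
      ball (nds_iter f i j x) e (nds_iter f i j y).
Proof.
move=> eqf; elim: k => [|k IHk] e e0; first by exists 1.
have [d1 d10 d1P] := IHk _ e0.
have [d2 d20 d2P] : exists2 d : R, 0 < d & forall i x y, ball x d y ->
    ball (nds_iter f i k x) e (nds_iter f i k y).
  case: k {d1P} IHk => [|k] IHk; first by exists e.
  have [e1 e10 e1P] := eqf e e0; have [d d0 dP] := IHk _ e10.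
  exists d => // i x y xy /=; rewrite ballEmdist; apply: e1P.
  by have := dP i k x y (ltnSn k) xy; rewrite ballEmdist.
exists (Num.min d1 d2); first by rewrite lt_min d10.
move=> i j x y; rewrite ltnS leq_eqVlt => /predU1P[->|jk] xy.
  by apply: d2P; apply: le_ball xy; rewrite ge_min lexx orbT.
by apply: d1P => //; apply: le_ball xy; rewrite ge_min lexx.
Qed.

(** V is obtained from balls whose images under all the partial iterates have
    radius below a Lebesgue number of U. *)
Lemma equicontinuous_cover (f : nat -> X -> X) (U : set (set X)) k :
  compact [set: X] -> equicontinuous_seq f -> finite_open_cover U ->
  exists2 V, finite_open_cover V & forall i j A, (j < k)%N -> V A ->
    exists2 B, U B & A `<=` nds_iter f i j @^-1` B.
Proof.
move=> cX eqf fU; have [e e0 eP] := lebesgue_number cX fU.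
have [d d0 dP] := equicontinuous_iter k eqf e0.
have [V fV VP] := finite_ball_cover cX d0.
exists V => // i j A jk /VP[x Ax].
have [B UB eB] := eP (nds_iter f i j x).
by exists B => // y /Ax xy; apply: eB; exact: dP.
Qed.

End lebesgue.

(** * Vanishing of upper and lower limits *)

Section limits.
Variable R : realType.
Implicit Type u : nat -> R.

Lemma limn_esup_eq0P u : (forall n, 0 <= u n) ->
  limn_esup (fun n => (u n)%:E) = 0%E <->
  forall e, 0 < e -> exists N, forall n, (N <= n)%N -> u n <= e.
Proof.
move=> u0; have supE : limn_esup (fun n => (u n)%:E) =
    ereal_inf (range (esups (fun n => (u n)%:E))).
  by rewrite limn_esup_lim; apply/cvg_lim => //; exact: cvg_esups_inf.
rewrite supE.
split=> [u_eq0 e e0|uP].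
  have : (ereal_inf (range (esups (fun n => (u n)%:E))) < e%:E)%E.
    by rewrite u_eq0 lte_fin.
  move=> /ereal_inf_lt[_ [N _ <-]] /ltW supN; exists N => n Nn.
  rewrite -lee_fin; apply: le_trans supN; apply: ereal_sup_ubound.
  by exists n.
apply/eqP; rewrite eq_le; apply/andP; split; last first.
  by rewrite -supE; apply: limf_esup_ge0 => //; exact: filter_not_empty.
apply/lee_addgt0Pr => e e0; rewrite add0e; have [N NP] := uP e e0.
apply: ge_ereal_inf; exists (esups (fun n => (u n)%:E) N); first by exists N.
by apply: ge_ereal_sup => _ [n /= Nn <-]; rewrite lee_fin NP.
Qed.

Lemma limn_einf_ge0 (v : nat -> \bar R) :
  (forall n, 0 <= v n)%E -> (0 <= limn_einf v)%E.
Proof.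
move=> v0; rewrite limn_einf_lim; apply: lime_ge; first exact: is_cvg_einfs.
by apply: nearW => n; apply: le_ereal_inf_tmp => _ [m _ <-].
Qed.

Lemma limn_einf_eq0P u : (forall n, 0 <= u n) ->
  limn_einf (fun n => (u n)%:E) = 0%E <->
  forall e, 0 < e -> forall N, exists2 n, (N <= n)%N & u n <= e.
Proof.
move=> u0; have infE : limn_einf (fun n => (u n)%:E) =
    ereal_sup (range (einfs (fun n => (u n)%:E))).
  by rewrite limn_einf_lim; apply/cvg_lim => //; exact: cvg_einfs_sup.
split=> [u_eq0 e e0 N|uP].
  have : (einfs (fun n => (u n)%:E) N < e%:E)%E.
    apply: (@le_lt_trans _ _ 0%E); last by rewrite lte_fin.
    by rewrite -u_eq0 infE; apply: ereal_sup_ubound; exists N.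
  move=> /ereal_inf_lt[_ [n /= Nn <-]]; rewrite lte_fin => /ltW une.
  by exists n.
apply/eqP; rewrite eq_le limn_einf_ge0 ?andbT// infE.
apply: ge_ereal_sup => _ [N _ <-].
apply/lee_addgt0Pr => e e0; rewrite add0e; have [n Nn une] := uP e e0 N.
by apply: ge_ereal_inf; exists (u n)%:E; [exists n|rewrite lee_fin].
Qed.

End limits.

(** * Transfer of vanishing entropy *)

Section entropy.
Variables (R : realType) (X : topologicalType) (K : set X).
Implicit Types (g h : nat -> X -> X) (U : set (set X)) (s : R).

Lemma finite_open_coverT : finite_open_cover [set [set: X]].
Proof.
split; first exact: finite_set1.
  by move=> _ ->; exact: openT.
by rewrite bigcup_set1.
Qed.

Lemma ln_nat_ge0 n : 0 <= ln (n%:R : R).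
Proof. by case: n => [|n]; [rewrite ln0|apply: ln_ge0; rewrite ler1n]. Qed.

(** The values of [cover_growth] as real numbers, so that the vanishing of its
    limits can be expressed by real inequalities. *)
Definition growth g s U n : R :=
  (n%:R `^ s)^-1 * ln (cover_number (cover_join g U n) K)%:R.

Lemma growth_ge0 g s U n : 0 <= growth g s U n.
Proof. by rewrite mulr_ge0// ?ln_nat_ge0// invr_ge0 powR_ge0. Qed.

Lemma upper_entropy_eq0P g s :
  upper_entropy K g s = 0%E <-> forall U, finite_open_cover U ->
  forall e, 0 < e -> exists N, forall n, (N <= n)%N -> growth g s U n <= e.
Proof.
split=> [h0 U fU|h0].
  apply/limn_esup_eq0P; first exact: growth_ge0.
  apply/eqP; rewrite eq_le; apply/andP; split.
    by rewrite -h0; apply: ereal_sup_ubound; exists U.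
  apply: limf_esup_ge0 => [|n]; first exact: filter_not_empty.
  by rewrite lee_fin growth_ge0.
rewrite /upper_entropy [X in ereal_sup X](_ : _ = [set 0%E]) ?ereal_sup1//.
have limU U : finite_open_cover U -> limn_esup (cover_growth K g s U) = 0%E.
  by move=> /h0 hU; apply/(limn_esup_eq0P (growth_ge0 g s U)).
apply/seteqP; split=> [_ [U fU <-]|_ ->]; first exact: limU.
by exists [set setT]; [|apply: limU]; exact: finite_open_coverT.
Qed.

Lemma lower_entropy_eq0P g s :
  lower_entropy K g s = 0%E <-> forall U, finite_open_cover U ->
  forall e, 0 < e -> forall N, exists2 n, (N <= n)%N & growth g s U n <= e.
Proof.
split=> [h0 U fU|h0].
  apply/limn_einf_eq0P; first exact: growth_ge0.
  apply/eqP; rewrite eq_le; apply/andP; split.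
    by rewrite -h0; apply: ereal_sup_ubound; exists U.
  by apply: limn_einf_ge0 => n; rewrite lee_fin growth_ge0.
rewrite /lower_entropy [X in ereal_sup X](_ : _ = [set 0%E]) ?ereal_sup1//.
have limU U : finite_open_cover U -> limn_einf (cover_growth K g s U) = 0%E.
  by move=> /h0 hU; apply/(limn_einf_eq0P (growth_ge0 g s U)).
apply/seteqP; split=> [_ [U fU <-]|_ ->]; first exact: limU.
by exists [set setT]; [|apply: limU]; exact: finite_open_coverT.
Qed.

Lemma growth_le g h s U V m n c : 0 <= s -> (0 < m)%N -> (0 < n)%N ->
  (n <= c * m)%N ->
  (cover_number (cover_join h U m) K <= cover_number (cover_join g V n) K)%N ->
  growth h s U m <= c%:R `^ s * growth g s V n.
Proof.
move=> s0 m0 n0 ncm Nhg; rewrite /growth.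
have [m0' n0'] : 0 < m%:R `^ s /\ 0 < n%:R `^ s by rewrite !powR_gt0 ?ltr0n.
rewrite mulrA; apply: ler_pM; rewrite ?invr_ge0 ?powR_ge0 ?ln_nat_ge0//.
  rewrite ler_pdivlMr// mulrC ler_pdivrMr// -powRM//.
  by rewrite ge0_ler_powR ?nnegrE// -natrM ler_nat.
move: Nhg; case: cover_number => [|p]; first by rewrite ln0// ln_nat_ge0.
by move=> pN; rewrite ler_ln ?posrE ?ltr0n ?ler_nat// (leq_trans _ pN).
Qed.

(** A time m lies below the next multiple of a, whose index m / a + 1
    corresponds for g to the time (m / a + 1) b <= 2 b m; this controls an upper
    limit.  For a lower limit, a good time n for g is rounded down to a multiple
    of b, which corresponds for h to the time (n / b) a, and
    n <= 2 b (n / b) a. *)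
Lemma entropy_eq0_transfer g h a b s : 0 <= s -> (0 < a)%N -> (0 < b)%N ->
  (forall U, finite_open_cover U -> exists2 V, finite_open_cover V & forall n,
    (cover_number (cover_join h U (n * a)) K <=
     cover_number (cover_join g V (n * b)) K)%N) ->
  (upper_entropy K g s = 0%E -> upper_entropy K h s = 0%E) /\
  (lower_entropy K g s = 0%E -> lower_entropy K h s = 0%E).
Proof.
move=> s0 a0 b0 hg.
have mono g' U m n : finite_open_cover U -> (m <= n)%N ->
    (cover_number (cover_join g' U m) K <= cover_number (cover_join g' U n) K)%N.
  move=> [finU _ covU] mn; apply: cover_number_le.
  - exact: finite_cover_join.
  - exact: cover_join_cover.
  - exact: cover_join_refines.
split.
  move=> /upper_entropy_eq0P g0; apply/upper_entropy_eq0P => U fU e e0.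
  have [V fV UV] := hg U fU.
  set c := (2 * b)%N; have c0 : 0 < c%:R `^ s by rewrite powR_gt0// ltr0n /c; lia.
  have [N NP] := g0 V fV _ (divr_gt0 e0 c0).
  (* the summand 1 keeps m positive, as needed by [growth_le] *)
  exists (N * a + 1)%N => m Nm.
  have ma := divn_eq m a; have mla := ltn_pmod m a0.
  have Nma : (N <= m %/ a)%N by rewrite leq_divRL//; lia.
  have ma' : (m %/ a <= m)%N := leq_div m a.
  apply: (@le_trans _ _ (c%:R `^ s * growth g s V ((m %/ a).+1 * b))); last first.
    by rewrite mulrC -ler_pdivlMr// NP// -[N]muln1 leq_mul// leqW.
  apply: growth_le => //; [lia|by rewrite muln_gt0 b0| |].
    by rewrite /c mulnAC leq_mul2r; lia.
  apply: leq_trans (UV _); apply: mono => //.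
  by rewrite mulSn {1}ma addnC leq_add2r ltnW.
move=> /lower_entropy_eq0P g0; apply/lower_entropy_eq0P => U fU e e0 N.
have [V fV UV] := hg U fU.
set c := (2 * b)%N; have c0 : 0 < c%:R `^ s by rewrite powR_gt0// ltr0n /c; lia.
(* the summand 1 keeps n / b positive *)
have [n Nn nP] := g0 V fV _ (divr_gt0 e0 c0) ((N + 1) * b)%N.
have nb := divn_eq n b; have nlb := ltn_pmod n b0.
have Nnb : (N + 1 <= n %/ b)%N by rewrite leq_divRL.
have aN : (n %/ b <= n %/ b * a)%N by rewrite leq_pmulr.
exists (n %/ b * a)%N; first lia.
apply: (@le_trans _ _ (c%:R `^ s * growth g s V n)).
  apply: growth_le => //; [lia| | |].
    by apply: leq_trans Nn; rewrite muln_gt0 addn1.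
    rewrite /c; apply: (@leq_trans (2 * b * (n %/ b)));
      last by rewrite leq_mul2l aN orbT.
    rewrite {1}nb -mulnA mul2n -addnn [(b * _)%N]mulnC leq_add2l.
    by rewrite (leq_trans (ltnW nlb))// leq_pmull//; lia.
  by apply: leq_trans (UV _) _; apply: mono => //; exact: leq_trunc_div.
by rewrite mulrC -ler_pdivlMr.
Qed.

Lemma lower_entropy_eq0 g s :
  upper_entropy K g s = 0%E -> lower_entropy K g s = 0%E.
Proof.
move=> /upper_entropy_eq0P g0; apply/lower_entropy_eq0P => U fU e e0 N.
have [M MP] := g0 U fU e e0.
by exists (maxn M N); [exact: leq_maxr|apply/MP/leq_maxl].
Qed.

Lemma ereal_inf_exponents_le (P Q : R -> Prop) :
  (forall s, 0 < s -> P s -> Q s) ->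
  (ereal_inf [set s%:E | s in [set s : R | (0 < s)%R /\ Q s]] <=
   ereal_inf [set s%:E | s in [set s : R | (0 < s)%R /\ P s]])%E.
Proof.
move=> PQ; apply: ereal_inf_le_tmp => _ [s [s0 Ps] <-].
by exists s => //; split => //; exact: PQ.
Qed.

Lemma upper_entropy_dim_le g h :
  (forall s, 0 < s -> upper_entropy K h s = 0%E -> upper_entropy K g s = 0%E) ->
  (upper_entropy_dim R K g <= upper_entropy_dim R K h)%E.
Proof. by move=> hg; exact: (ereal_inf_exponents_le hg). Qed.

Lemma lower_entropy_dim_le g h :
  (forall s, 0 < s -> lower_entropy K h s = 0%E -> lower_entropy K g s = 0%E) ->
  (lower_entropy_dim R K g <= lower_entropy_dim R K h)%E.
Proof. by move=> hg; exact: (ereal_inf_exponents_le hg). Qed.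

Lemma lower_entropy_dim_le_upper g :
  (lower_entropy_dim R K g <= upper_entropy_dim R K g)%E.
Proof. exact: (ereal_inf_exponents_le (fun s _ => @lower_entropy_eq0 g s)). Qed.

End entropy.

Local Open Scope ereal_scope.

Theorem theorem3p12 (R : realType) (X : metricType R) (f : nat -> X -> X)
    (K : set X) (k : nat) :
  compact [set: X] ->
  (forall i : nat, continuous (f i)) ->
  K !=set0 ->
  equicontinuous_seq f ->
  (1 <= k)%N ->
  [/\ upper_entropy_dim R K (nds_power f k) = upper_entropy_dim R K f,
      upper_entropy_dim R K f >= lower_entropy_dim R K (nds_power f k) &
      lower_entropy_dim R K (nds_power f k) = lower_entropy_dim R K f].
Proof.
move=> cX _ _ eqf k0.
have f_power (s : R) : (0 <= s)%R ->
    (upper_entropy K f s = 0 -> upper_entropy K (nds_power f k) s = 0) /\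
    (lower_entropy K f s = 0 -> lower_entropy K (nds_power f k) s = 0).
  move=> s0; apply: (@entropy_eq0_transfer _ _ _ _ _ 1 k) => // U fU.
  have [finU _ covU] := fU; exists U => // n; rewrite muln1.
  apply: cover_number_le; first exact: finite_cover_join.
    exact: cover_join_cover.
  exact: cover_join_power_refines.
have power_f (s : R) : (0 <= s)%R ->
    (upper_entropy K (nds_power f k) s = 0 -> upper_entropy K f s = 0) /\
    (lower_entropy K (nds_power f k) s = 0 -> lower_entropy K f s = 0).
  move=> s0; apply: (@entropy_eq0_transfer _ _ _ _ _ k 1) => // U fU.
  have [V fV UV] := equicontinuous_cover k cX eqf fU.
  have [finV _ covV] := fV; exists V => // n; rewrite muln1.
  apply: cover_number_le; first exact: finite_cover_join.
    exact: cover_join_cover.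
  exact: cover_join_refines_power.
have lowerE : lower_entropy_dim R K (nds_power f k) = lower_entropy_dim R K f.
  apply: le_anti; apply/andP; split; apply: lower_entropy_dim_le => s /ltW s0.
    exact: (f_power s s0).2.
  exact: (power_f s s0).2.
split; [|rewrite lowerE; exact: lower_entropy_dim_le_upper|exact: lowerE].
apply: le_anti; apply/andP; split; apply: upper_entropy_dim_le => s /ltW s0.
  exact: (f_power s s0).1.
exact: (power_f s s0).1.
Qed.
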